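(* Let $\lambda\in\mathbb{R}$ and let $n,r\ge 0$ be integers. Then \[ D_rF_{n,\lambda}(x)=\sum_{k=0}^{n}\binom{k+r}{k}k!\,S_{2,\lambda}(n,k)\,x^k, \] where $D_r$ is the linear operator on polynomials given by $D_rq(x)=\frac{1}{r!}\big(\frac{d}{dx}\big)^r\big[x^rq(x)\big]$.
   Context: For $\lambda\in\mathbb{R}$, the generalized falling factorials are $(x)_{0,\lambda}=1$ and $(x)_{n,\lambda}=x(x-\lambda)(x-2\lambda)\cdots(x-(n-1)\lambda)$ for $n\ge 1$; $(x)_n$ denotes the ordinary falling factorial $x(x-1)\cdots(x-n+1)$. The degenerate Stirling numbers of the second kind $S_{2,\lambda}(n,k)$ are defined by $(x)_{n,\lambda}=\sum_{k=0}^{n}S_{2,\lambda}(n,k)(x)_k$. The degenerate exponential is $e_\lambda(t)=\sum_{n\ge 0}(1)_{n,\lambda}\frac{t^n}{n!}$, and the degenerate Fubini polynomials are defined by $\frac{1}{1-x(e_\lambda(t)-1)}=\sum_{n=0}^{\infty}F_{n,\lambda}(x)\frac{t^n}{n!}$; equivalently $F_{n,\lambda}(x)=\sum_{k=0}^{n}k!\,S_{2,\lambda}(n,k)x^k$. *)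

(* Defs.v *)
From mathcomp Require Import all_boot all_order all_algebra.
From mathcomp Require Import ring.
From mathcomp Require Import reals.

Set Implicit Arguments.
Unset Strict Implicit.
Unset Printing Implicit Defensive.

Import Order.TTheory GRing.Theory Num.Theory.
Local Open Scope ring_scope.

(* (x)_{n,lam} = x (x - lam) ... (x - (n-1) lam) *)
Definition dffact (R : realType) (lam x : R) (n : nat) : R :=
  \prod_(i < n) (x - i%:R * lam).

(* (x)_n = x (x - 1) ... (x - n + 1) *)
Definition rffact (R : realType) (x : R) (n : nat) : R :=
  \prod_(i < n) (x - i%:R).

(* S n k = S_{2,lam}(n,k) for k <= n.  The defining relation says nothing about
   S n k with k > n; existence, and uniqueness for k <= n, are
   [deg_stirling2_exists] and [deg_stirling2_unique]. *)
Definition is_deg_stirling2 (R : realType) (lam : R) (S : nat -> nat -> R) :=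
  forall (n : nat) (x : R),
    dffact lam x n = \sum_(k < n.+1) S n k * rffact x k.

(* A formal power series in t is the sequence of its coefficients; here the
   coefficients are polynomials in x, with x represented by 'X. *)
Definition fps (R : realType) := nat -> {poly R}.

Definition fps_one (R : realType) : fps R := fun n => (n == 0)%:R.

Definition fps_sub (R : realType) (a b : fps R) : fps R := fun n => a n - b n.

Definition fps_scale (R : realType) (c : {poly R}) (a : fps R) : fps R :=
  fun n => c * a n.

Definition fps_mul (R : realType) (a b : fps R) : fps R :=
  fun n => \sum_(i < n.+1) a i * b (n - i)%N.

(* \sum_n a_n t^n / n! *)
Definition egf (R : realType) (a : nat -> {poly R}) : fps R :=
  fun n => (n`!%:R)^-1 *: a n.

Definition deg_exp (R : realType) (lam : R) : fps R :=
  egf (fun n => (dffact lam 1 n)%:P).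

(* \sum_n F_n(x) t^n / n! = 1 / (1 - x (e_lam(t) - 1)) as formal power series
   in t: the left-hand side is the multiplicative inverse of the denominator.
   There is exactly one such F ([deg_fubini_exists], [deg_fubini_unique]). *)
Definition is_deg_fubini (R : realType) (lam : R) (F : nat -> {poly R}) :=
  fps_mul
    (fps_sub (fps_one R) (fps_scale 'X (fps_sub (deg_exp lam) (fps_one R))))
    (egf F)
  =1 fps_one R.

Definition D_op (R : realType) (r : nat) (q : {poly R}) : {poly R} :=
  (r`!%:R)^-1 *: ('X^r * q)^`(r).

Section WellDefined.
Variables (R : realType) (lam : R).

Fixpoint stirling_rec (n k : nat) : R :=
  if n is m.+1 then
    (if k is j.+1 then stirling_rec m j else 0)
    + (k%:R - m%:R * lam) * stirling_rec m k
  else (k == 0)%:R.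

Let stirling_rec_gt n k : (n < k)%N -> stirling_rec n k = 0.
Proof.
elim: n k => [|n IH] [|k] //= nk.
by rewrite !IH ?mulr0 ?addr0 // ltnW.
Qed.

Lemma deg_stirling2_exists : exists S, is_deg_stirling2 lam S.
Proof.
exists stirling_rec => n x; elim: n => [|n IH].
  by rewrite big_ord1 /dffact /rffact !big_ord0 mulr1.
rewrite {1}/dffact big_ord_recr /= -/(dffact lam x n) IH mulr_suml.
have -> : \sum_(i < n.+1) stirling_rec n i * rffact x i * (x - n%:R * lam) =
  \sum_(i < n.+1) stirling_rec n i * rffact x i.+1 +
  \sum_(i < n.+1) (i%:R - n%:R * lam) * stirling_rec n i * rffact x i.
  rewrite -big_split /=; apply: eq_bigr => i _.
  by rewrite /rffact big_ord_recr /=; ring.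
transitivity (\sum_(k < n.+2) (if (k : nat) is j.+1 then stirling_rec n j else 0) * rffact x k +
  \sum_(k < n.+2) (k%:R - n%:R * lam) * stirling_rec n k * rffact x k).
  congr (_ + _); first by rewrite [RHS]big_ord_recl mul0r add0r.
  by rewrite [RHS]big_ord_recr /= stirling_rec_gt // mulr0 mul0r addr0.
by rewrite -big_split; apply: eq_bigr => i _; rewrite /= -mulrDl.
Qed.

Lemma deg_stirling2_unique S S' n k :
  is_deg_stirling2 lam S -> is_deg_stirling2 lam S' -> (k <= n)%N ->
  S n k = S' n k.
Proof.
move=> hS hS'; elim/ltn_ind: k => k IH kn.
have := hS n k%:R; rewrite (hS' n k%:R).
have E (T : nat -> nat -> R) : \sum_(i < n.+1) T n i * rffact (k%:R : R) i =
    \sum_(i < k) T n i * rffact (k%:R : R) i + T n k * rffact (k%:R : R) k.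
  rewrite -(big_mkord predT (fun i => T n i * rffact (k%:R : R) i)).
  rewrite (big_cat_nat _ (n := k.+1)) //= big_mkord big_ord_recr /=.
  rewrite [X in _ + X]big_nat_cond [X in _ + X]big1 ?addr0 // => i /andP[/andP[ki _] _].
  by rewrite /rffact (bigD1 (Ordinal ki)) //= subrr mul0r mulr0.
rewrite !E.
under eq_bigr => i _ do rewrite -IH ?(leq_trans (ltnW (ltn_ord i)) kn) //.
move/addrI/mulIf => -> //.
apply/prodf_neq0 => i _; rewrite -natrB ?pnatr_eq0 ?subn_eq0 -?ltnNge //.
exact: ltnW.
Qed.

Let den : fps R :=
  fps_sub (fps_one R) (fps_scale 'X (fps_sub (deg_exp lam) (fps_one R))).

Let den0 : den 0 = 1.
Proof.
rewrite /den /fps_sub /fps_scale /fps_one /deg_exp /egf /dffact /=.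
by rewrite big_ord0 invr1 scale1r subrr mulr0 subr0.
Qed.

Fixpoint inv_rec (m n : nat) : {poly R} :=
  if m is m'.+1 then
    (n == 0)%:R - \sum_(i < n) den i.+1 * inv_rec m' (n - i.+1)
  else 0.

Let inv_rec_stable m m' n :
  (n < m)%N -> (n < m')%N -> inv_rec m n = inv_rec m' n.
Proof.
elim: m m' n => [|m IH] [|m'] n //= nm nm'; congr (_ - _).
apply: eq_bigr => i _; congr (_ * _).
have lt p : (n < p.+1)%N -> (n - i.+1 < p)%N.
  rewrite ltnS; apply: leq_trans.
  by rewrite ltn_subrL (leq_ltn_trans _ (ltn_ord i)).
by apply: IH; apply: lt.
Qed.

Let facN0 n : (n`!%:R : R) != 0.
Proof. by rewrite pnatr_eq0 -lt0n fact_gt0. Qed.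

Lemma deg_fubini_exists : exists F, is_deg_fubini lam F.
Proof.
exists (fun n => n`!%:R *: inv_rec n.+1 n) => n; rewrite -/den /fps_mul.
under eq_bigr => i _ do rewrite /egf scalerA mulVf // scale1r.
rewrite big_ord_recl /= den0 mul1r subn0 -addrA.
rewrite [X in _ + X](_ : _ = 0) ?addr0 // addrC; apply/eqP; rewrite subr_eq0.
apply/eqP/eq_bigr => i _; rewrite /bump /= add1n; congr (_ * _).
have ni : (n - i.+1 < n)%N by rewrite ltn_subrL (leq_ltn_trans _ (ltn_ord i)).
exact: (inv_rec_stable (ltnSn (n - i.+1)) ni).
Qed.

Lemma deg_fubini_unique F F' :
  is_deg_fubini lam F -> is_deg_fubini lam F' -> F =1 F'.
Proof.
move=> hF hF' n; elim/ltn_ind: n => n IH.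
have := hF n; rewrite -(hF' n) -/den /fps_mul !big_ord_recl /= den0 !mul1r subn0.
rewrite (eq_bigr (fun i : 'I_n => den (bump 0 i) * egf F' (n - bump 0 i)%N)).
  move/addIr; rewrite /egf; apply: scalerI; exact: invr_neq0.
move=> i _; rewrite /egf IH // /bump add1n ltn_subrL.
exact: leq_ltn_trans (ltn_ord i).
Qed.

End WellDefined.

(* Main.v *)
(* The shift identity (x + 1)_{n,lam} = \sum_i C(n, i) (1)_{i,lam} (x)_{n-i,lam},
   expanded in the falling factorial basis, gives
   (k + 1) S(n, k + 1) = \sum_{i >= 1} C(n, i) (1)_{i,lam} S(n - i, k).
   This says exactly that the polynomials \sum_k k! S(n, k) x^k are the
   coefficients of 1 / (1 - x (e_lam(t) - 1)), so they are the degenerate Fubini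
   polynomials; and D_r maps x^k to C(k + r, k) x^k. *)
Require Import Defs.
From mathcomp Require Import all_boot all_order all_algebra.
From mathcomp Require Import ring.
From mathcomp Require Import reals.

Import GRing.Theory Num.Theory.
Local Open Scope ring_scope.

Lemma dffactS (R : realType) (lam x : R) n :
  dffact lam x n.+1 = dffact lam x n * (x - n%:R * lam).
Proof. by rewrite /dffact big_ord_recr. Qed.

(** Induction on [n]: in the [i]-th term the new factor [x + y - n lam] splits as
    [(y - i lam) + (x - (n - i) lam)], and Pascal's rule recombines the two halves. *)
Lemma dffactD (R : realType) (lam x y : R) n :
  dffact lam (x + y) n =
  \sum_(i < n.+1) 'C(n, i)%:R * dffact lam y i * dffact lam x (n - i).
Proof.
elim: n => [|n IH].
  by rewrite big_ord1 /dffact !big_ord0 !mulr1.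
rewrite dffactS IH mulr_suml [RHS]big_ord_recl.
under [in RHS]eq_bigr => i _ do rewrite lift0 binS natrD !mulrDl subSS.
rewrite big_split /= addrA.
have -> : 'C(n.+1, 0)%:R * dffact lam y 0 * dffact lam x (n.+1 - 0) +
    \sum_(i < n.+1) 'C(n, i.+1)%:R * dffact lam y i.+1 * dffact lam x (n - i) =
    \sum_(i < n.+2) 'C(n, i)%:R * dffact lam y i * dffact lam x (n.+1 - i).
  by rewrite [RHS]big_ord_recl !bin0.
rewrite [X in _ = X + _]big_ord_recr /= bin_small // !mul0r addr0 -big_split /=.
apply: eq_bigr => i _.
have lein : (i <= n)%N by rewrite -ltnS.
by rewrite subSn // !dffactS natrB //; ring.
Qed.

Lemma rffactS (R : realType) (x : R) k :
  rffact x k.+1 = rffact x k * (x - k%:R).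
Proof. by rewrite /rffact big_ord_recr. Qed.

(** Both sides share the factor [rffact x k], and [x + 1 = (x - k) + (k + 1)]. *)
Lemma rffact_shift (R : realType) (x : R) k :
  rffact (x + 1) k.+1 = rffact x k.+1 + k.+1%:R * rffact x k.
Proof.
have -> : rffact (x + 1) k.+1 = (x + 1) * rffact x k.
  rewrite /rffact big_ord_recl subr0; congr (_ * _).
  by apply: eq_bigr => i _; rewrite lift0 -add1n natrD; ring.
by rewrite rffactS -[k.+1]addn1 natrD; ring.
Qed.

Lemma rffact_sum_shift (R : realType) (a : nat -> R) x N :
  \sum_(k < N.+1) a k * rffact (x + 1) k =
  \sum_(k < N.+1) a k * rffact x k + \sum_(k < N) k.+1%:R * a k.+1 * rffact x k.
Proof.
rewrite big_ord_recl [in RHS]big_ord_recl -addrA -big_split.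
congr (_ + _); first by rewrite /rffact !big_ord0.
by apply: eq_bigr => i _; rewrite !lift0 rffact_shift /=; ring.
Qed.

Lemma rffact_gt (R : realType) m k : (m < k)%N -> rffact (m%:R : R) k = 0.
Proof. by move=> mk; rewrite /rffact (bigD1 (Ordinal mk)) //= subrr mul0r. Qed.

Lemma rffact_neq0 (R : realType) m : rffact (m%:R : R) m != 0.
Proof.
apply/prodf_neq0 => i _; rewrite subr_eq0 eqr_nat.
by rewrite gtn_eqF.
Qed.

(** The system is triangular: at [x = k] the terms of index above [k] vanish, those below agree by
    induction, and [rffact k k] is nonzero. *)
Lemma rffact_basis (R : realType) N (a b : nat -> R) :
  (forall x, \sum_(k < N) a k * rffact x k = \sum_(k < N) b k * rffact x k) ->
  forall k, (k < N)%N -> a k = b k.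
Proof.
move=> hab; elim/ltn_ind => k IH kN; have := hab k%:R.
rewrite (bigD1 (Ordinal kN)) // [in RHS](bigD1 (Ordinal kN)) //=.
rewrite [in RHS](eq_bigr (fun i : 'I_N => a i * rffact (k%:R : R) i)).
  by move/addIr/(mulIf (rffact_neq0 R k)).
move=> i; rewrite -val_eqE /= neq_ltn => /orP[ik|ki]; first by rewrite IH.
by rewrite rffact_gt ?mulr0.
Qed.

(* [is_deg_stirling2] leaves S n k arbitrary for k > n, hence the truncation. *)
Definition stirling_trunc {R : realType} (S : nat -> nat -> R) n k : R :=
  if (k <= n)%N then S n k else 0.

Section DegenerateFubini.
Variables (R : realType) (lam : R) (S : nat -> nat -> R).
Hypothesis hS : is_deg_stirling2 lam S.
Let T := stirling_trunc S.

(** The free bound [N] lets expansions of different degrees [n - i] share one index range. *)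
Lemma dffact_stirling_trunc n N x :
  (n < N)%N -> dffact lam x n = \sum_(k < N) T n k * rffact x k.
Proof.
move=> nN; rewrite hS (big_ord_widen N (fun k => S n k * rffact x k)) //.
rewrite big_mkcond; apply: eq_bigr => k _.
by rewrite /T /stirling_trunc ltnS; case: ifP; rewrite ?mul0r.
Qed.

Lemma stirling_trunc_rec n k :
  k.+1%:R * T n k.+1 =
  \sum_(i < n) 'C(n, i.+1)%:R * dffact lam 1 i.+1 * T (n - i.+1)%N k.
Proof.
pose N := (n + k).+1; have kN : (k < N)%N by rewrite ltnS leq_addl.
have nN : (n < N)%N by rewrite ltnS leq_addr.
apply: (rffact_basis R N (fun k => k.+1%:R * T n k.+1) (fun k => \sum_(i < n) _))
  kN => x.
have := dffactD R lam x 1 n.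
rewrite big_ord_recl /= bin0 subn0 {2}/dffact big_ord0 !mul1r.
rewrite (dffact_stirling_trunc _ N.+1 (x + 1)) ?(leqW nN) //.
rewrite (dffact_stirling_trunc _ N.+1 x) ?(leqW nN) //.
(* The term [i = 0] of [dffactD] is [dffact lam x n] itself; it cancels the unshifted half of the
   left-hand side. *)
rewrite rffact_sum_shift => /addrI ->.
under [RHS]eq_bigr => j _ do rewrite mulr_suml.
rewrite exchange_big; apply: eq_bigr => i _ /=.
rewrite /bump /= add1n (dffact_stirling_trunc _ N x) ?(leq_ltn_trans (leq_subr _ _)) //.
by rewrite mulr_sumr; apply: eq_bigr => j _; rewrite mulrA.
Qed.

Definition fubini_poly n : {poly R} := \poly_(k < n.+1) (k`!%:R * S n k).

Lemma coef_fubini_poly n k : (fubini_poly n)`_k = k`!%:R * T n k.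
Proof.
by rewrite coef_poly ltnS /T /stirling_trunc; case: ifP; rewrite ?mulr0.
Qed.

Lemma fubini_poly_rec n :
  fubini_poly n = (n == 0%N)%:R +
  'X * \sum_(i < n) ('C(n, i.+1)%:R * dffact lam 1 i.+1) *: fubini_poly (n - i.+1).
Proof.
apply/polyP => -[|k].
  rewrite coefD coefXM addr0 coef_fubini_poly mul1r.
  (* At [x = 0] only [T n 0] survives, and [dffact lam 0 n] has a zero factor unless [n = 0]. *)
  have := dffact_stirling_trunc n n.+1 0 (ltnSn n).
  rewrite big_ord_recl big1 => [|i _]; last first.
    by rewrite (rffact_gt R 0) ?mulr0.
  rewrite /rffact big_ord0 mulr1 addr0 => <-.
  case: n => [|n]; first by rewrite /dffact big_ord0 coef1.
  by rewrite /dffact big_ord_recl mul0r subrr mul0r coef0.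
rewrite coefD coefXM coef_fubini_poly /= coef_sum.
have -> : ((n == 0%N)%:R : {poly R})`_k.+1 = 0 by case: eqP; rewrite ?coef1 ?coef0.
rewrite add0r factS mulnC natrM -mulrA stirling_trunc_rec mulr_sumr.
by apply: eq_bigr => i _; rewrite coefZ coef_fubini_poly; ring.
Qed.

(** Divided by [n!], the recurrence [fubini_poly_rec] is the coefficient of [t^n] in the defining
    product, since [C(n, i + 1) / n! = 1 / ((i + 1)! (n - i - 1)!)]. *)
Lemma fubini_poly_is_deg_fubini : is_deg_fubini lam fubini_poly.
Proof.
move=> n; have facN0 m : (m`!%:R : R) != 0 by rewrite pnatr_eq0 -lt0n fact_gt0.
rewrite /fps_mul big_ord_recl subn0 /fps_sub /fps_scale /fps_one /deg_exp /egf.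
rewrite /= [in dffact _ _ _]/dffact big_ord0 invr1 scale1r subrr mulr0 subr0 mul1r.
rewrite fubini_poly_rec scalerDr -addrA.
have -> : n`!%:R^-1 *: ((n == 0%N)%:R : {poly R}) = (n == 0%N)%:R.
  by case: eqP => [->|_]; rewrite ?invr1 ?scale1r ?scaler0.
rewrite mulr_sumr scaler_sumr -big_split /= big1 ?addr0 // => i _.
rewrite /bump /= add1n sub0r subr0 -scalerAr scalerA.
have -> : n`!%:R^-1 * ('C(n, i.+1)%:R * dffact lam 1 i.+1) =
    i.+1`!%:R^-1 * dffact lam 1 i.+1 * (n - i.+1)`!%:R^-1.
  have binN0 : 'C(n, i.+1)%:R != 0 :> R by rewrite pnatr_eq0 -lt0n bin_gt0.
  rewrite -(bin_fact (ltn_ord i)) (natrM _ 'C(n, i.+1)) (natrM _ i.+1`!).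
  move: (facN0 i.+1) (facN0 (n - i.+1)%N) binN0.
  move: (i.+1`!%:R : R) ((n - i.+1)`!%:R : R) ('C(n, i.+1)%:R : R) => a b c.
  by move=> a0 b0 c0; field; apply/and3P.
by rewrite -!mul_polyC !polyCM; ring.
Qed.

End DegenerateFubini.

(** Dividing by [r!] turns the [r]-th derivative into the Hasse derivative, whose binomial
    [C(r + k, r)] equals [C(k + r, k)] by symmetry. *)
Lemma coef_D_op (R : realType) r (q : {poly R}) k :
  (D_op r q)`_k = 'C(k + r, k)%:R * q`_k.
Proof.
rewrite /D_op nderivn_def -scaler_nat scalerA mulVf ?pnatr_eq0 -?lt0n ?fact_gt0 //.
rewrite scale1r coef_nderivn coefXnM ltnNge leq_addr addKn mulr_natl.
by rewrite addnC -[in RHS]bin_sub ?leq_addr // addKn.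
Qed.

Theorem theorem10 (R : realType) (lam : R)
    (S2 : nat -> nat -> R) (hS : is_deg_stirling2 lam S2)
    (F : nat -> {poly R}) (hF : is_deg_fubini lam F)
    (n r : nat) :
  D_op r (F n) =
  \sum_(k < n.+1) ('C(k + r, k)%:R * k`!%:R * S2 n k) *: 'X^k.
Proof.
rewrite (deg_fubini_unique hF (fubini_poly_is_deg_fubini _ _ _ hS)).
rewrite -(poly_def n.+1 (fun k => 'C(k + r, k)%:R * k`!%:R * S2 n k)).
apply/polyP => k; rewrite coef_D_op !coef_poly.
by case: ifP; rewrite ?mulr0 // mulrA.
Qed.
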